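(* The non-parametric Lipschitz (NPL) hypothesis class $\mathcal{H}$ is $(\alpha,\delta)$-PAC learnable with sample complexity $$O\Big(\frac1{\alpha^2}\big(\log\frac1\delta+\frac{T^{T+1}}{\alpha^T}\big)\Big).$$ That is, there is a constant $C$ depending only on $M$, $\hat K$ and $K$ such that for all $T\ge 2$ with $T>K$ and all $\alpha,\delta\in(0,1)$, the class $\mathcal{H}$ is $(\alpha,\delta)$-PAC learnable with $m$ samples whenever $m\ge\frac{C}{\alpha^2}\big(\log\frac1\delta+\frac{T^{T+1}}{\alpha^T}\big)$.
   Context: Setting. $T$ is the number of targets, $K\ge1$ an integer (number of defender resources, small compared with $T$), $X=\{x\in[0,1]^T:\sum_{i=1}^T x_i\le K\}$, $Y=\{\mathrm{t}_1,\dots,\mathrm{t}_T\}$ with $\mathrm{t}_i$ the $i$-th unit vector of $\mathbb{R}^T$ (attack on target $i$), $Z=X\times Y$; $M>1$ and $\hat K>0$ are fixed constants. NPL class. $\mathcal{H}$ consists of all functions $h=\langle h_1,\dots,h_{T-1}\rangle:X\to[-\frac M2,\frac M2]^{T-1}$ such that each component $h_i$ is $L$-Lipschitz for some $L\le\hat K$, i.e. $|h_i(x)-h_i(x')|\le\hat K\|x-x'\|_1$ for all $x,x'\in X$. Loss and risks. $l(\mathrm{t}_i,a)=-\log\frac{e^{a_i}}{1+\sum_{j=1}^{T-1}e^{a_j}}$ for $a\in\mathbb{R}^{T-1}$, with $a_T:=0$. For a distribution $p$ on $Z$, $r_h(p)=E_{(x,y)\sim p}[l(y,h(x))]$; for $\vec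 z=((x_1,y_1),\dots,(x_m,y_m))$, $\hat r_h(\vec z)=\frac1m\sum_{i=1}^m l(y_i,h(x_i))$. PAC learnability. $\mathcal{H}$ is $(\alpha,\delta)$-PAC learnable with $m$ samples if there is an algorithm $\mathcal{A}$ mapping samples to hypotheses in $\mathcal{H}$ such that for every distribution $p$ on $Z$ and $\vec z$ consisting of $m$ i.i.d. draws from $p$: (i) $Pr(\forall h\in\mathcal{H}:|\hat r_h(\vec z)-r_h(p)|<\alpha/3)>1-\delta/2$, and (ii) $Pr(|\hat r_{\mathcal{A}(\vec z)}(\vec z)-\inf_{h\in\mathcal{H}}\hat r_h(\vec z)|<\alpha/3)>1-\delta/2$. (These imply $Pr(|r_{\mathcal{A}(\vec z)}(p)-\inf_{h\in\mathcal{H}}r_h(p)|<\alpha)>1-\delta$.) *)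

(* Defs.v *)
From HB Require Import structures.
From mathcomp Require Import all_boot all_order all_algebra.
From mathcomp Require Import all_classical all_reals all_analysis.
Set Implicit Arguments. Unset Strict Implicit. Unset Printing Implicit Defensive.
Import Order.TTheory GRing.Theory Num.Theory.
Import numFieldNormedType.Exports.
Local Open Scope classical_set_scope.
Local Open Scope ring_scope.

(* Throughout, the number of targets is T = n.+1, so that T >= 1 (which makes
   the types below inhabited) and T - 1 = n. *)

Definition defender_set (R : realType) (n K : nat) : set (n.+1.-tuple R) :=
  [set x | (forall i, 0 <= tnth x i <= 1) /\ \sum_i tnth x i <= K%:R].

Arguments defender_set : clear implicits.

Record defender (R : realType) (n K : nat) := Defender {
  defender_val :> n.+1.-tuple R;
  defender_valP : defender_set R n K defender_val }.

HB.instance Definition _ (R : realType) (n K : nat) :=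
  gen_eqMixin (defender R n K).
HB.instance Definition _ (R : realType) (n K : nat) :=
  gen_choiceMixin (defender R n K).

Lemma defender_set0 (R : realType) (n K : nat) :
  defender_set R n K [tuple 0 | i < n.+1].
Proof.
split=> [i|]; first by rewrite tnth_mktuple lexx ler01.
by rewrite big1 ?ler0n// => i _; rewrite tnth_mktuple.
Qed.

HB.instance Definition _ (R : realType) (n K : nat) :=
  isPointed.Build (defender R n K) (Defender (defender_set0 R n K)).

(* trace of the Borel sigma-algebra of R^T *)
HB.instance Definition _ (R : realType) (n K : nat) := Measurable.copy
  (defender R n K) (g_sigma_algebra_preimageType (@defender_val R n K)).

HB.instance Definition _ (n : nat) := isPointed.Build 'I_n.+1 ord0.

HB.instance Definition _ (n : nat) := @isMeasurable.Build
  default_measure_display 'I_n.+1 discrete_measurable discrete_measurable0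
  discrete_measurableC discrete_measurableU.

(* Y is the set of unit vectors of R^T, each encoded by its index: the target
   t_i is i : 'I_n.+1 (with the discrete sigma-algebra). *)
Notation observation R n K := (defender R n K * 'I_n.+1)%type.

Definition l1_dist (R : realType) (n K : nat) (x x' : defender R n K) : R :=
  \sum_i `|tnth x i - tnth x' i|.

Definition NPL_class (R : realType) (n K : nat) (M Khat : R) :
    set (defender R n K -> 'rV[R]_n) :=
  [set h | (forall x i, - (M / 2) <= h x 0 i <= M / 2) /\
           (forall i x x', `|h x 0 i - h x' 0 i| <= Khat * l1_dist x x')].
Arguments NPL_class : clear implicits.

(* a_i for i < T, with the convention a_T = 0 *)
Definition logit (R : realType) (n : nat) (a : 'rV[R]_n) (i : 'I_n.+1) : R :=
  if unlift ord_max i is Some j then a 0 j else 0.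

Definition loss (R : realType) (n : nat) (i : 'I_n.+1) (a : 'rV[R]_n) : R :=
  - ln (expR (logit a i) / (1 + \sum_(j < n) expR (a 0 j))).

(* kept extended-real so that no convention on non-integrable losses is used *)
Definition risk (R : realType) (n K : nat)
    (p : probability (observation R n K) R)
    (h : defender R n K -> 'rV[R]_n) : \bar R :=
  ('E_p[fun z => loss z.2 (h z.1)])%E.

Definition emp_risk (R : realType) (n K m : nat)
    (z : m.-tuple (observation R n K)) (h : defender R n K -> 'rV[R]_n) : R :=
  (m%:R)^-1 * \sum_(i < m) loss (tnth z i).2 (h (tnth z i).1).

Definition iid (R : realType) d d' (W : measurableType d)
    (Z : measurableType d') (P : probability W R) (p : probability Z R)
    (m : nat) (S : 'I_m -> {RV P >-> Z}) : Prop :=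
  (forall i B, measurable B -> P (S i @^-1` B) = p B) /\
  (forall (J : {set 'I_m}) (B : 'I_m -> set Z),
     (forall i, measurable (B i)) ->
     P (\bigcap_(i in [set` J]) (S i @^-1` B i)) =
     (\prod_(i in J) P (S i @^-1` B i))%E).

(* The measurability clause makes the value of P on E meaningful. *)
Definition prob_gt (R : realType) d (W : measurableType d)
    (P : probability W R) (E : set W) (r : R) : Prop :=
  measurable E /\ (r%:E < P E)%E.

(* The algorithm A is a function of the sample with values in H; it is chosen
   before the distribution p. *)
Definition PAC_learnable (R : realType) (n K : nat)
    (H : set (defender R n K -> 'rV[R]_n)) (alpha delta : R) (m : nat) : Prop :=
  exists A : m.-tuple (observation R n K) -> (defender R n K -> 'rV[R]_n),
  (forall z, H (A z)) /\
  forall (p : probability (observation R n K) R)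
         (d : measure_display) (W : measurableType d) (P : probability W R)
         (S : 'I_m -> {RV P >-> observation R n K}),
    iid p S ->
    let z w := [tuple S i w | i < m] in
    prob_gt P
      [set w | forall h, H h ->
        (`|(emp_risk (z w) h)%:E - risk p h| < (alpha / 3)%:E)%E]
      (1 - delta / 2) /\
    prob_gt P
      [set w | `|emp_risk (z w) (A (z w)) -
                 inf [set emp_risk (z w) h | h in H]| < alpha / 3]
      (1 - delta / 2).

(* Main.v *)
From HB Require Import structures.
Require Import Defs.
From mathcomp Require Import all_boot all_order all_algebra.
From mathcomp Require Import all_classical all_reals all_analysis.
From mathcomp Require Import ring lra zify.
Import Order.TTheory GRing.Theory Num.Theory.
Import numFieldNormedType.Exports.
Local Open Scope classical_set_scope.
Local Open Scope ring_scope.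

Set Implicit Arguments.
Unset Strict Implicit.
Unset Printing Implicit Defensive.

(** Part (ii) of learnability only needs a near-minimiser of the empirical risk,
    chosen for every sample.  For part (i), put on the defender set the grid of
    mesh 1/N with N of order T / alpha; the number of its points is at most
    'C(T + K N, T), hence at most a constant times (T / alpha)^T, because
    c^T / T! <= e^c.  Rounding the values of a Lipschitz function on the grid to
    multiples of alpha / 48, neighbouring values differ by at most one step, so a
    component is described by one value and an increment in {-1, 0, 1} per grid
    point; this avoids a factor log (1 / alpha) in the metric entropy.  The loss
    deviates from ln T by at most M, so that Hoeffding's inequality and a union
    bound over the resulting net give the sample size with a constant independent
    of T.  The uniform event is measurable because the class is compact
    (Tychonoff), which reduces it to countably many hypotheses. *)

(** * Hoeffding's inequality *)

(** Since [expR y * (1 - y) <= expR y * expR (- y) = 1], it is enough that [(1 + y + 2 * y ^+ 2) *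
    (1 - y) = 1 + y ^+ 2 * (1 - 2 * y)] is at least 1. *)
Lemma expR_le_quadratic (R : realType) (y : R) :
  y <= 2^-1 -> expR y <= 1 + y + 2 * y ^+ 2.
Proof.
move=> y2.
have e0 := expR_gt0 y.
have e1 : expR y * (1 - y) <= 1.
  rewrite -[leRHS](expRxMexpNx_1 y) ler_wpM2l ?expR_ge0//.
  exact: expR_ge1Dx.
have y1 : 0 < 1 - y by lra.
rewrite -(ler_pM2r y1) (le_trans e1)//.
have : 0 <= y ^+ 2 * (1 - 2 * y) by rewrite mulr_ge0 ?sqr_ge0//; lra.
by nra.
Qed.

(** Chernoff's method under the product law of [pi]: weight each outcome by the exponential of [l]
    times its excess over [m * t], factorise, and bound each factor by the quadratic estimate. *)
Lemma product_sum_tail (R : realType) (Q : finType) (pi Y : Q -> R) (B t : R)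
    (m : nat) :
  (forall v, 0 <= pi v) -> \sum_v pi v = 1 -> \sum_v pi v * Y v = 0 ->
  0 < B -> (forall v, `|Y v| <= B) -> 0 < t -> t <= 2 * B ->
  \sum_(v : {ffun 'I_m -> Q} | m%:R * t <= \sum_i Y (v i)) \prod_i pi (v i) <=
  expR (- (m%:R * t ^+ 2 / (8 * B ^+ 2))).
Proof.
move=> pi0 pi1 piY B0 YB t0 tB.
(* This [l] minimises the exponent [2 * (l * B) ^+ 2 - l * t], and [t <= 2 * B] keeps [l * B] in the
   range of the quadratic estimate. *)
pose l := t / (4 * B ^+ 2).
have B20 : 0 < B ^+ 2 by rewrite exprn_gt0.
have l0 : 0 < l by rewrite divr_gt0// mulr_gt0.
have lB : l * B <= 2^-1.
  rewrite /l -(ler_pM2r B0).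
  have -> : t / (4 * B ^+ 2) * B * B = t / 4 by field; rewrite gt_eqF.
  by lra.
have step v : expR (l * Y v) <= 1 + l * Y v + 2 * (l * B) ^+ 2.
  apply: le_trans (expR_le_quadratic _) _.
    apply: le_trans lB; rewrite ler_pM2l//.
    by apply: le_trans (YB v); rewrite ler_norm.
  rewrite lerD2l ler_pM2l// (exprMn _ l) (exprMn _ l) ler_pM2l ?exprn_gt0//.
  by rewrite -[Y v ^+ 2]real_normK ?num_real// lerXn2r ?nnegrE ?normr_ge0// ltW.
have mgf : \sum_v pi v * expR (l * (Y v - t)) <=
    expR (- (t ^+ 2 / (8 * B ^+ 2))).
  under eq_bigr do rewrite mulrBr expRD mulrA.
  rewrite -mulr_suml.
  have : \sum_v pi v * expR (l * Y v) <= 1 + 2 * (l * B) ^+ 2.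
    apply: (@le_trans _ _ (\sum_v (pi v * (1 + 2 * (l * B) ^+ 2) + l * (pi v * Y v)))).
      apply: ler_sum => v _; apply: le_trans (ler_wpM2l (pi0 v) (step v)) _.
      by rewrite le_eqVlt; apply/orP; left; apply/eqP; ring.
    by rewrite big_split/= -mulr_suml pi1 -mulr_sumr piY mulr0 addr0 mul1r.
  move=> /le_trans/(_ (expR_ge1Dx _)) h.
  apply: le_trans (ler_wpM2r (expR_ge0 _) h) _.
  rewrite -expRD ler_expR /l le_eqVlt; apply/orP; left; apply/eqP.
  by field; rewrite gt_eqF.
have pe0 v : 0 <= pi v * expR (l * (Y v - t)) by rewrite mulr_ge0 ?expR_ge0.
apply: (@le_trans _ _ (\prod_(i < m) \sum_v pi v * expR (l * (Y v - t)))).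
  (* The product of sums expands over all value vectors; on the tail the exponential weight is at
     least 1, elsewhere the terms are nonnegative. *)
  rewrite bigA_distr_bigA/= [leRHS](bigID (fun v : {ffun 'I_m -> Q} =>
    m%:R * t <= \sum_i Y (v i)))/= -[leLHS]addr0 lerD//; last first.
    by apply: sumr_ge0 => v _; exact: prodr_ge0.
  apply: ler_sum => v vt; rewrite big_split/= ler_peMr ?prodr_ge0//.
  rewrite -expR_sum -expR0 ler_expR -mulr_sumr mulr_ge0 ?(ltW l0)//.
  by rewrite sumrB sumr_const card_ord -mulr_natl subr_ge0.
rewrite prodr_const card_ord.
apply: le_trans (lerXn2r _ _ _ mgf) _; rewrite ?nnegrE ?expR_ge0 ?sumr_ge0//.
by rewrite -expRM_natl mulrN -mulrA.
Qed.

Lemma measure_le_sum_fin d (T : measurableType d) (R : realType)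
    (mu : {measure set T -> \bar R}) (I : finType) (C : pred I)
    (A : I -> set T) (E : set T) :
  measurable E -> (forall i, C i -> measurable (A i)) ->
  (forall x, E x -> exists2 i, C i & A i x) ->
  (mu E <= \sum_(i | C i) mu (A i))%E.
Proof.
move=> mE mA EA.
have key s : measurable (\big[setU/set0]_(i <- s | C i) A i) /\
    (mu (\big[setU/set0]_(i <- s | C i) A i) <= \sum_(i <- s | C i) mu (A i))%E.
  elim: s => [|i s [mS ih]]; first by rewrite !big_nil measure0.
  rewrite !big_cons; case: ifP => // Ci; split; first exact/measurableU/mS/mA.
  by apply: le_trans (measureU2 _ _ _) _ => //; [exact: mA|exact: leeD2l].
have [mS /(le_trans _)] := key (index_enum I); apply.
apply: le_measure; rewrite ?inE// => x /EA[i Ci Aix].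
by rewrite -bigcup_seq_cond; exists i => //=; rewrite mem_index_enum.
Qed.

(** * Finite-valued images of an iid sample *)

Section iid_finite_law.
Context (R : realType) d d' (W : measurableType d) (Z : measurableType d')
  (P : probability W R) (p : probability Z R) (m : nat)
  (S : 'I_m -> {RV P >-> Z}) (Q : finType) (q : Z -> Q).
Hypothesis SP : iid p S.
Hypothesis mq : forall v, measurable (q @^-1` [set v]).

Lemma measurable_iid_finite (D : pred {ffun 'I_m -> Q}) :
  measurable [set w | D [ffun i => q (S i w)]].
Proof.
have -> : [set w | D [ffun i => q (S i w)]] =
   \bigcup_(v in [set` D]) \bigcap_(i in [set: 'I_m]) (S i @^-1` (q @^-1` [set v i])).
  apply/seteqP; split=> [w Dw|w [v Dv vw]].
    by exists [ffun i => q (S i w)] => //= i _; rewrite /= ffunE.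
  rewrite /= (_ : [ffun i => q (S i w)] = v)//.
  by apply/ffunP => i; rewrite ffunE; exact: vw.
apply: fin_bigcup_measurable => // v _.
apply: fin_bigcap_measurable => // i _.
by rewrite -[X in measurable X]setTI; exact: measurable_funP.
Qed.

(** The event is covered by the events that fix the whole vector of values, and independence over
    the full index set factorises each of these. *)
Lemma iid_finite_law (D : pred {ffun 'I_m -> Q}) :
  (P [set w | D [ffun i => q (S i w)]] <=
   (\sum_(v | D v) \prod_i fine (p (q @^-1` [set v i])))%:E)%E.
Proof.
have [Sp Sind] := SP.
apply: (@le_trans _ _ (\sum_(v | D v)
    P (\bigcap_(i in [set` [set: 'I_m]%SET])
      (S i @^-1` (q @^-1` [set (v : {ffun 'I_m -> Q}) i]))))%E).
  apply: measure_le_sum_fin; first exact: measurable_iid_finite.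
    move=> v _; apply: fin_bigcap_measurable => // i _.
    by rewrite -[X in measurable X]setTI; exact: measurable_funP.
  by move=> w Dw; exists [ffun i => q (S i w)] => // i _; rewrite /= ffunE.
rewrite -sumEFin; apply: lee_sum => v _.
rewrite Sind//.
rewrite -prodEFin le_eqVlt; apply/orP; left; apply/eqP.
apply: eq_big => [i|i _]; first by rewrite inE.
by rewrite Sp// fineK// fin_num_measure.
Qed.

End iid_finite_law.

(** * Means of bounded functions *)

Section bounded_mean.
Context d (Z : measurableType d) (R : realType) (p : probability Z R).
Implicit Types f g : Z -> R.

Lemma bounded_integrable f (B : R) : measurable_fun [set: Z] f ->
  (forall z, `|f z| <= B) -> p.-integrable [set: Z] (EFin \o f).
Proof.
move=> mf fB; apply: measurable_bounded_integrable => //.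
  by rewrite (le_lt_trans (probability_le1 _ _))// ltry.
by exists B; split; [exact: num_real|move=> x /ltW Bx z _; exact: le_trans (fB z) Bx].
Qed.

Lemma Rintegral_probability_cst (r : R) : \int[p]_z r = r.
Proof.
rewrite Rintegral_cst//.
rewrite -[RHS]mulr1; congr (_ * _).
exact: (congr1 fine (probability_setT p)).
Qed.

Lemma Rintegral_dist_le f g (e : R) :
  p.-integrable [set: Z] (EFin \o f) -> p.-integrable [set: Z] (EFin \o g) ->
  (forall z, `|f z - g z| <= e) ->
  `|\int[p]_z f z - \int[p]_z g z| <= e.
Proof.
move=> intf intg fg.
have ie : p.-integrable [set: Z] (EFin \o cst e).
  by apply: (@bounded_integrable _ `|e|) => //; exact: measurable_cst.
rewrite -RintegralB//; apply: le_trans (le_normr_Rintegral _ _) _ => //.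
  exact: (integrableB measurableT intf intg).
have ifg := integrable_norm (integrableB measurableT intf intg).
apply: (@le_trans _ _ (\int[p]_z e)); first exact: le_Rintegral.
by rewrite Rintegral_probability_cst.
Qed.

Lemma Rintegral_finite (Q : finType) (q : Z -> Q) (g : Q -> R) :
  (forall v, measurable (q @^-1` [set v])) ->
  \int[p]_z g (q z) = \sum_v fine (p (q @^-1` [set v])) * g v.
Proof.
move=> mq; rewrite /Rintegral.
under eq_integral => z _.
  rewrite (_ : (g (q z))%:E =
    \sum_v ((g v)%:E * (\1_(q @^-1` [set v]) z)%:E))%E; last first.
    rewrite (bigD1 (q z))//= big1 => [|v vq].
      by rewrite indicE mem_set//= mule1 adde0.
    by rewrite indicE memNset ?mule0// => /= /esym/eqP; exact/negP.
  over.
have im v : p.-integrable [set: Z] (fun z => (\1_(q @^-1` [set v]) z)%:E).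
  exact: integrable_indic.
rewrite integral_sum//=; last by move=> v; exact: integrableZl.
rewrite (eq_bigr (fun v => (fine (p (q @^-1` [set v])) * g v)%:E)).
  by rewrite sumEFin.
move=> v _; rewrite integralZl// integral_indic// setIT muleC EFinM fineK//.
exact: fin_num_measure.
Qed.

End bounded_mean.

Section Hoeffding.
Context (R : realType) d d' (W : measurableType d) (Z : measurableType d')
  (P : probability W R) (p : probability Z R) (m : nat)
  (S : 'I_m -> {RV P >-> Z}).
Hypothesis SP : iid p S.

(** Centring doubles the bound [B], which turns the constant 8 of [product_sum_tail] into 32; the
    factor 2 adds the two tails. *)
Lemma Hoeffding_finite (Q : finType) (q : Z -> Q) (g : Q -> R) (B t : R) :
  (forall v, measurable (q @^-1` [set v])) ->
  0 < B -> (forall v, `|g v| <= B) -> 0 < t -> t <= 4 * B ->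
  (P [set w | (m%:R * t <= `|\sum_i (g (q (S i w)) - \int[p]_z g (q z))|)%R] <=
  (2 * expR (- (m%:R * t ^+ 2 / (32 * B ^+ 2))))%:E)%E.
Proof.
move=> mq B0 gB t0 tB; rewrite Rintegral_finite//.
set pi := fun v => fine (p (q @^-1` [set v])).
have pi0 v : 0 <= pi v by rewrite fine_ge0.
have pi1 : \sum_v pi v = 1.
  have := @Rintegral_finite _ _ _ p Q q (fun=> 1) mq.
  rewrite Rintegral_probability_cst => ->.
  by apply: eq_bigr => v _; rewrite mulr1.
set mu := \sum_v _.
have muB : `|mu| <= B.
  apply: le_trans (ler_norm_sum _ _ _) _.
  rewrite -[B]mul1r -pi1 mulr_suml; apply: ler_sum => v _.
  by rewrite normrM (ger0_norm (pi0 v)) ler_wpM2l.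
(* The sign [s] treats the upper and the lower tail by one argument. *)
have tail (s : R) : `|s| = 1 ->
    (P [set w | (m%:R * t <= \sum_i s * (g (q (S i w)) - mu))%R] <=
    (expR (- (m%:R * t ^+ 2 / (32 * B ^+ 2))))%:E)%E.
  move=> s1.
  have := @iid_finite_law _ _ _ _ _ _ _ _ _ _ _ SP mq
    (fun v => m%:R * t <= \sum_i s * (g (v i) - mu)).
  under [X in P X]eq_set do under eq_bigr do rewrite ffunE.
  move=> /le_trans; apply; rewrite lee_fin.
  have -> : 32 * B ^+ 2 = 8 * (2 * B) ^+ 2 by ring.
  apply: (@product_sum_tail _ _ pi (fun v => s * (g v - mu))) => //;
    last lra; last 1 first.
  - move=> v; rewrite normrM s1 mul1r; apply: le_trans (ler_normB _ _) _.
    by have := gB v; lra.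
  - under eq_bigr do rewrite mulrCA mulrBr.
    by rewrite -mulr_sumr sumrB -mulr_suml pi1 mul1r subrr mulr0.
  - by rewrite mulr_gt0.
have mt s : measurable [set w | m%:R * t <= \sum_i s * (g (q (S i w)) - mu)].
  have := @measurable_iid_finite _ _ _ _ _ P m S _ q mq
    (fun v => m%:R * t <= \sum_i s * (g (v i) - mu)).
  by under eq_set do under eq_bigr do rewrite ffunE.
have e w : \sum_i (-1) * (g (q (S i w)) - mu) = - \sum_i (g (q (S i w)) - mu).
  by rewrite -mulr_sumr mulN1r.
have e' w : \sum_i 1 * (g (q (S i w)) - mu) = \sum_i (g (q (S i w)) - mu).
  by rewrite -mulr_sumr mul1r.
have -> : [set w | m%:R * t <= `|\sum_i (g (q (S i w)) - mu)|] =
    [set w | m%:R * t <= \sum_i 1 * (g (q (S i w)) - mu)] `|`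
    [set w | m%:R * t <= \sum_i (-1) * (g (q (S i w)) - mu)].
  by apply/seteqP; split=> w /=; rewrite e e' ler_normr => /orP.
apply: le_trans (measureU2 _ (mt _) (mt _)) _.
rewrite mulrDl mul1r EFinD; apply: leeD; apply: tail.
  by rewrite normr1.
by rewrite normrN1.
Qed.

(* [f] is rounded down to a multiple of [t / 4], which makes it finite-valued. *)
Lemma Hoeffding_bounded (f : Z -> R) (B t : R) :
  measurable_fun [set: Z] f ->
  0 < B -> (forall z, `|f z| <= B) -> 0 < t -> t <= 8 * B ->
  (P [set w | (m%:R * t <= `|\sum_i (f (S i w) - \int[p]_z f z)|)%R] <=
  (2 * expR (- (m%:R * t ^+ 2 / (128 * B ^+ 2))))%:E)%E.
Proof.
move=> mf B0 fB t0 tB.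
pose eta := t / 4.
have eta0 : 0 < eta by rewrite divr_gt0.
pose b := Num.truncn (2 * B / eta).
pose k z := Num.truncn ((f z + B) / eta).
have fB0 z : 0 <= (f z + B) / eta.
  by rewrite divr_ge0 ?(ltW eta0)//; have := fB z; rewrite ler_norml; lra.
have kb z : (k z < b.+1)%N.
  rewrite ltnS le_truncn// ler_pM2r ?invr_gt0//.
  by have := fB z; rewrite ler_norml; lra.
pose q z : 'I_b.+1 := inord (k z).
pose g (v : 'I_b.+1) := v%:R * eta - B.
have kP z : (k z)%:R * eta <= f z + B < (k z).+1%:R * eta.
  by rewrite -ler_pdivlMr// -ltr_pdivrMr// truncn_itv.
have qk z : q z = k z :> nat by rewrite inordK.
have fg z : `|f z - g (q z)| <= eta.
  rewrite /g qk; have := kP z; rewrite -natr1 mulrDl mul1r ler_norml.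
  by move: ((k z)%:R * eta) => u /andP[u0 u1]; apply/andP; split; lra.
have mq v : measurable (q @^-1` [set v]).
  have -> : q @^-1` [set v] = f @^-1` `[v%:R * eta - B, v.+1%:R * eta - B[%classic.
    apply/seteqP; split=> z /=; rewrite in_itv/= => h.
      by have := kP z; rewrite -h qk lerBlDr ltrBrDr.
    apply/val_inj; rewrite /= qk; apply: truncn_def.
    by rewrite ler_pdivlMr// ltr_pdivrMr// -lerBlDr -ltrBrDr.
  by rewrite -[X in measurable X]setTI; apply: mf => //; exact: measurable_itv.
have gB v : `|g v| <= B.
  have : v%:R * eta <= 2 * B.
    rewrite -ler_pdivlMr//.
    apply: (@le_trans _ _ b%:R); first by rewrite ler_nat -ltnS.
    by rewrite truncn_le divr_ge0 ?mulr_ge0 ?ltW.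
  have : 0 <= v%:R * eta by rewrite mulr_ge0 ?(ltW eta0).
  rewrite ler_norml /g; move: (v%:R * eta) => u u0 uB.
  by apply/andP; split; lra.
have mg : measurable_fun [set: Z] (g \o q).
  move=> _ A mA; rewrite setTI.
  have -> : (g \o q) @^-1` A = \bigcup_(v in [set v | A (g v)]) (q @^-1` [set v]).
    by apply/seteqP; split=> z /= => [Az|[v] /[swap] /= <-//]; exists (q z).
  exact: fin_bigcup_measurable.
have int_fg : `|\int[p]_z f z - \int[p]_z g (q z)| <= eta.
  apply: (@Rintegral_dist_le _ _ _ _ _ (g \o q)) => //.
    exact: (@bounded_integrable _ _ _ _ _ B).
  by apply: (@bounded_integrable _ _ _ _ _ B) => //= z; exact: gB.
(* Rounding costs [t / 4] in the value and [t / 4] in the mean, so the rounded function still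
   deviates by [t / 2]; this explains [128 = 4 * 32]. *)
have -> : 128 * B ^+ 2 = 4 * (32 * B ^+ 2) by ring.
have -> : m%:R * t ^+ 2 / (4 * (32 * B ^+ 2)) =
    m%:R * (t / 2) ^+ 2 / (32 * B ^+ 2) by field; rewrite gt_eqF.
apply: le_trans (@Hoeffding_finite _ q g B (t / 2) mq B0 gB _ _); last 2 first.
- by rewrite divr_gt0.
- by lra.
have mS i (h : Z -> R) : measurable_fun [set: Z] h ->
    measurable_fun [set: W] (fun w => h (S i w) - \int[p]_z h z).
  move=> mh; apply: measurable_realfun.measurable_funB; last exact: measurable_cst.
  exact: measurableT_comp.
have mE (h : Z -> R) (u : R) : measurable_fun [set: Z] h ->
    measurable [set w | u <= `|\sum_i (h (S i w) - \int[p]_z h z)|].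
  move=> mh.
  have : measurable_fun [set: W] (fun w => `|\sum_i (h (S i w) - \int[p]_z h z)|).
    apply: measurableT_comp => //; apply: measurable_sum => i; exact: mS.
  move=> /(_ measurableT `[u, +oo[%classic (measurable_itv _)); rewrite setTI.
  by congr measurable; apply/seteqP; split=> w /=; rewrite in_itv/= andbT.
apply: le_measure; rewrite ?inE; [exact: mE|exact: (mE (g \o q))|].
move=> w /= h.
have : `|\sum_i (f (S i w) - \int[p]_z f z) -
    \sum_i (g (q (S i w)) - \int[p]_z g (q z))| <= m%:R * (t / 2).
  rewrite -sumrB; apply: le_trans (ler_norm_sum _ _ _) _.
  rewrite -[m in m%:R]card_ord mulr_natl -sumr_const; apply: ler_sum => i _.
  have := fg (S i w); move: int_fg; rewrite !ler_norml /eta; lra.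
move=> /(le_trans (ler_dist_dist _ _)); move: h.
by move: `|_| `|_| => x y; rewrite ler_norml; lra.
Qed.

End Hoeffding.

(** * The grid on the defender set *)

(** Coordinates run up to [K * N] instead of [N], so that only the sum constrains them and the count
    is a single binomial coefficient. *)
Definition grid (n K N : nat) : Type :=
  {t : n.+1.-tuple 'I_(K * N).+1 | (\sum_(i <- t) i <= K * N)%N}.

HB.instance Definition _ n K N := Finite.on (grid n K N).

Lemma card_grid n K N : #|{: grid n K N}| = 'C(n.+1 + K * N, n.+1).
Proof.
rewrite card_sig -card_partial_ord_partitions cardsE.
by apply: eq_card => t; rewrite !inE.
Qed.

Section grid.
Context (R : realType) (n K N : nat).
Hypothesis N0 : (0 < N)%N.
Local Notation grid := (grid n K N).

Definition grid_coord (k : grid) (i : 'I_n.+1) : nat := tnth (val k) i.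

Lemma sum_grid_coord (k : grid) : (\sum_i grid_coord k i <= K * N)%N.
Proof. by have := valP k; rewrite big_tuple. Qed.

Lemma grid_point_subproof (k : grid) :
  defender_set R n K [tuple (minn (grid_coord k i) N)%:R / N%:R | i < n.+1].
Proof.
have NR : 0 < N%:R :> R by rewrite ltr0n.
split=> [i|].
  by rewrite tnth_mktuple divr_ge0//= ler_pdivrMr// mul1r ler_nat geq_minr.
under eq_bigr do rewrite tnth_mktuple.
rewrite -mulr_suml ler_pdivrMr// -natr_sum -natrM ler_nat.
by apply: leq_trans (sum_grid_coord k); apply: leq_sum => i _; exact: geq_minl.
Qed.

(* Indices need not be at most [N], hence the truncation. *)
Definition grid_point (k : grid) : defender R n K :=
  Defender (grid_point_subproof k).

Lemma tnth_grid_point k i :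
  tnth (grid_point k) i = (minn (grid_coord k i) N)%:R / N%:R.
Proof. by rewrite tnth_mktuple. Qed.

Definition cell_coord (x : defender R n K) (i : 'I_n.+1) : nat :=
  Num.truncn (N%:R * tnth x i).

Lemma cell_coord_itv x i :
  (cell_coord x i)%:R <= N%:R * tnth x i < (cell_coord x i).+1%:R.
Proof.
by rewrite truncn_itv// mulr_ge0//; have [/(_ i)/andP[]] := defender_valP x.
Qed.

(** Rounding down cannot increase the sum, so the cell of a point is again a grid index. *)
Lemma sum_cell_coord x : (\sum_i cell_coord x i <= K * N)%N.
Proof.
rewrite -(ler_nat R) natr_sum natrM mulrC.
apply: (@le_trans _ _ (\sum_i N%:R * tnth x i)).
  by apply: ler_sum => i _; have /andP[] := cell_coord_itv x i.
by rewrite -mulr_sumr ler_wpM2l//; have [] := defender_valP x.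
Qed.

Lemma cell_coord_lt x i : (cell_coord x i < (K * N).+1)%N.
Proof.
rewrite ltnS; apply: leq_trans (sum_cell_coord x).
by rewrite (bigD1 i)//= leq_addr.
Qed.

Lemma cell_subproof x :
  (\sum_(i <- [tuple Ordinal (cell_coord_lt x i) | i < n.+1]) i <= K * N)%N.
Proof.
rewrite big_tuple; apply: leq_trans (sum_cell_coord x).
by apply: leq_sum => i _; rewrite tnth_mktuple.
Qed.

Definition cell (x : defender R n K) : grid :=
  exist _ [tuple Ordinal (cell_coord_lt x i) | i < n.+1] (cell_subproof x).

Lemma grid_coord_cell x i : grid_coord (cell x) i = cell_coord x i.
Proof. by rewrite /grid_coord tnth_mktuple. Qed.

Lemma l1_dist_cell x : l1_dist x (grid_point (cell x)) <= n.+1%:R / N%:R.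
Proof.
have NR : 0 < N%:R :> R by rewrite ltr0n.
rewrite /l1_dist -[n.+1 in leRHS]card_ord -sum1_card natr_sum mulr_suml.
apply: ler_sum => i _.
(* The truncation at [N] is inactive here because [tnth x i <= 1]. *)
rewrite tnth_grid_point grid_coord_cell (minn_idPl _); last first.
  rewrite -(ler_nat R); have /andP[+ _] := cell_coord_itv x i.
  move=> /le_trans; apply; rewrite -[leRHS]mulr1 ler_wpM2l//.
  by have [/(_ i)/andP[]] := defender_valP x.
have -> : tnth x i - (cell_coord x i)%:R / N%:R =
    (N%:R * tnth x i - (cell_coord x i)%:R) / N%:R.
  by field; rewrite gt_eqF.
rewrite normrM [`|N%:R^-1|]gtr0_norm ?invr_gt0// ler_pM2r ?invr_gt0//.
by have := cell_coord_itv x i; rewrite -natr1 ler_norml; lra.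
Qed.

(** A cell is the trace of a box with half-open sides. *)
Lemma measurable_cell k : measurable (cell @^-1` [set k]).
Proof.
have NR : 0 < N%:R :> R by rewrite ltr0n.
have -> : cell @^-1` [set k] = \bigcap_(i in [set: 'I_n.+1])
    ((fun x : defender R n K => tnth x i) @^-1`
      `[(grid_coord k i)%:R / N%:R, (grid_coord k i).+1%:R / N%:R[).
  apply/seteqP; split=> [x <- i _|x xk] /=.
    rewrite in_itv/= grid_coord_cell ler_pdivrMr// ltr_pdivlMr//.
    by rewrite [tnth x i * _]mulrC cell_coord_itv.
  apply/val_inj/eq_from_tnth => i; apply/val_inj.
  rewrite -[LHS]/(grid_coord (cell x) i) grid_coord_cell.
  have := xk i I; rewrite /= in_itv/= ler_pdivrMr// ltr_pdivlMr//.
  by rewrite [tnth x i * _]mulrC => /truncn_def.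
apply: fin_bigcap_measurable => // i _.
have mval : measurable_fun [set: defender R n K] (@defender_val R n K).
  move=> _ A mA; rewrite setTI; by exists A => //; rewrite setTI.
have mi := measurableT_comp (measurable_tnth i) mval.
rewrite -[X in measurable X]setTI.
exact: (mi measurableT _ (measurable_itv _)).
Qed.

End grid.

Section Lipschitz_on_defender.
Context (R : realType) (n K : nat) (L : R) (f : defender R n K -> R).
Hypothesis L0 : 0 <= L.
Hypothesis fL : forall x x', `|f x - f x'| <= L * l1_dist x x'.

Lemma Lipschitz_cell N (N0 : (0 < N)%N) x :
  `|f x - f (grid_point R N0 (cell N x))| <= L * (n.+1%:R / N%:R).
Proof. by apply: le_trans (fL _ _) _; rewrite ler_wpM2l ?l1_dist_cell. Qed.

(** The function is the pointwise limit of functions constant on the cells of ever finer grids. *)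
Lemma Lipschitz_measurable : measurable_fun [set: defender R n K] f.
Proof.
apply: (@measurable_realfun.measurable_fun_cvg _ _ _ _
    (fun N x => f (grid_point R (ltn0Sn N) (cell N.+1 x)))) => [N|x _].
  move=> _ A mA; rewrite setTI.
  have -> : (fun x => f (grid_point R (ltn0Sn N) (cell N.+1 x))) @^-1` A =
      \bigcup_(k in [set k | A (f (grid_point R (ltn0Sn N) k))])
      (@cell R n K N.+1 @^-1` [set k]).
    apply/seteqP; split=> x /= => [Ax|[k] /[swap] /= <-//].
    by exists (cell N.+1 x).
  by apply: fin_bigcup_measurable => // k _; exact: measurable_cell.
apply/cvgrPdist_le => e e0; near=> N.
apply: le_trans (Lipschitz_cell (ltn0Sn N) x) _.
rewrite mulrA ler_pdivrMr ?ltr0n// mulrC -ler_pdivrMl//.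
apply: le_trans (_ : N%:R <= _); last by rewrite ler_nat.
near: N; exact: nbhs_infty_ger.
Unshelve. all: by end_near. Qed.

End Lipschitz_on_defender.

(** * Metric entropy of the NPL class *)

(* Such a function is determined by its value at the root and its increments
   along the edges, each of which lies in {-1, 0, 1}. *)
Lemma card_tree_unit_increments (G : finType) (b : nat) (par : G -> G)
    (rank : G -> nat) (r : G) :
  (forall k, k != r -> (rank (par k) < rank k)%N) ->
  (#|[pred a : {ffun G -> 'I_b.+1} |
      [forall k, (a k <= (a (par k)).+1)%N && (a (par k) <= (a k).+1)%N]]| <=
   b.+1 * 3 ^ #|G|)%N.
Proof.
move=> rank_par; set good := [pred a | _].
(* Adding 1 moves the increment to {0, 1, 2}, so that on [good] the subtraction in [nat] does not
   truncate. *)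
pose enc (a : {ffun G -> 'I_b.+1}) : 'I_b.+1 * {ffun G -> 'I_3} :=
  (a r, [ffun k => inord (a k + 1 - a (par k))]).
have enc_inj : {in good &, injective enc}.
  move=> a1 a2 /forallP g1 /forallP g2 [er] /ffunP einc.
  suff key m k : (rank k <= m)%N -> a1 k = a2 k.
    by apply/ffunP => k; exact: key (leqnn _).
  elim: m k => [|m ih] k km; have [->//|kr] := eqVneq k r.
    by have := rank_par _ kr; rewrite ltnNge (leq_trans km).
  have epar : a1 (par k) = a2 (par k).
    by apply: ih; rewrite -ltnS (leq_trans (rank_par _ kr)).
  have /andP[u1 l1] := g1 k; have /andP[u2 l2] := g2 k.
  have := einc k; rewrite !ffunE => /(congr1 val)/=.
  rewrite !inordK; [|lia..].
  by rewrite epar in l1 * => e; apply/val_inj => /=; lia.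
rewrite -(card_in_imset enc_inj) (leq_trans (max_card _))//.
by rewrite card_prod card_ffun !card_ord.
Qed.

(** * A spanning tree of the grid *)

Section parent.
Context (n K N : nat).
Local Notation grid := (grid n K N).
Implicit Types k : grid.

Definition grid_rank k : nat := \sum_i grid_coord k i.

(** An edge of the tree lowers a single positive coordinate, chosen by [pick]; the origin has none
    and is its own parent. *)
Definition parent_coord k (i : 'I_n.+1) : nat :=
  grid_coord k i - (Some i == [pick j | (0 < grid_coord k j)%N]).

Lemma parent_coord_lt k i : (parent_coord k i < (K * N).+1)%N.
Proof. exact: leq_ltn_trans (leq_subr _ _) (ltn_ord (tnth (val k) i)). Qed.

Lemma parent_subproof k :
  (\sum_(i <- [tuple Ordinal (parent_coord_lt k i) | i < n.+1]) i <= K * N)%N.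
Proof.
rewrite big_tuple; apply: leq_trans (sum_grid_coord k).
by apply: leq_sum => i _; rewrite tnth_mktuple leq_subr.
Qed.

Definition parent k : grid :=
  exist _ [tuple Ordinal (parent_coord_lt k i) | i < n.+1] (parent_subproof k).

Lemma grid_coord_parent k i : grid_coord (parent k) i = parent_coord k i.
Proof. by rewrite /grid_coord tnth_mktuple. Qed.

Lemma origin_subproof :
  (\sum_(i <- [tuple (@ord0 (K * N)) | _ < n.+1]) i <= K * N)%N.
Proof. by rewrite big_tuple big1// => i _; rewrite tnth_mktuple. Qed.

Definition origin : grid :=
  exist _ [tuple (@ord0 (K * N)) | _ < n.+1] origin_subproof.

Lemma grid_rank_parent k : k != origin -> (grid_rank (parent k) < grid_rank k)%N.
Proof.
move=> k0; rewrite /grid_rank.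
under eq_bigr do rewrite grid_coord_parent /parent_coord.
case: pickP => [j kj|k_eq0]; last first.
  case/eqP: k0; apply/val_inj/eq_from_tnth => i; rewrite tnth_mktuple.
  by apply/val_inj => /=; apply/eqP; rewrite -leqn0 leqNgt; exact/negbT/k_eq0.
rewrite (bigD1 j)//= [ltnRHS](bigD1 j)//= eqxx -addSn leq_add//.
  by rewrite subn1 prednK.
by apply: leq_sum => i _; rewrite leq_subr.
Qed.

(** At most one coordinate changes, by one step; the truncation at [N] may even make the two points
    coincide. *)
Lemma l1_dist_parent (R : realType) (N0 : (0 < N)%N) k :
  l1_dist (grid_point R N0 k) (grid_point R N0 (parent k)) <= N%:R^-1.
Proof.
have NR : 0 < N%:R :> R by rewrite ltr0n.
have dist0 i : Some i != [pick j | (0 < grid_coord k j)%N] ->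
    `|tnth (grid_point R N0 k) i - tnth (grid_point R N0 (parent k)) i| = 0.
  move=> /negPf ij.
  by rewrite !tnth_grid_point grid_coord_parent /parent_coord ij subn0 subrr normr0.
rewrite /l1_dist; case: pickP dist0 => [j kj|k_eq0] dist0; last first.
  by rewrite big1 ?invr_ge0 ?ltW// => i _; exact: dist0.
rewrite (bigD1 j)// big1 => [|i ij]; last first.
  by apply: dist0; apply: contraNneq ij => -[->].
rewrite -[leLHS]/(_ + 0) addr0.
rewrite !tnth_grid_point grid_coord_parent /parent_coord -mulrBl normrM.
rewrite [`|N%:R^-1|]gtr0_norm ?invr_gt0// ler_piMl ?invr_ge0 ?(ltW NR)//.
rewrite ler_norml.
set u := minn (grid_coord k j) N; set v := minn (_ - _) N.
have [h1 h2] : (u <= v + 1)%N /\ (v <= u + 1)%N.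
  by rewrite /u /v; split; case: (_ == _); lia.
by move: h1 h2; rewrite -!(ler_nat R) !natrD; lra.
Qed.

End parent.

Section net.
Context (R : realType) (n K : nat) (M Khat : R).
Hypotheses (M0 : 0 <= M) (Khat0 : 0 <= Khat).
Local Notation H := (NPL_class R n K M Khat).

Lemma NPL_class0 : H (fun=> 0).
Proof.
split=> [x i|i x x']; rewrite !mxE ?subr0 ?normr0.
  by rewrite oppr_le0 divr_ge0.
by rewrite mulr_ge0// sumr_ge0.
Qed.

(** Moving to the grid point of the cell costs the Lipschitz error once for each of the two
    functions. *)
Lemma NPL_close_on_grid (N : nat) (N0 : (0 < N)%N) h h' i (e : R) : H h -> H h' ->
  (forall k, `|h (grid_point R N0 k) 0 i - h' (grid_point R N0 k) 0 i| <= e) ->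
  forall x, `|h x 0 i - h' x 0 i| <= e + 2 * (Khat * (n.+1%:R / N%:R)).
Proof.
move=> [_ hL] [_ hL'] hk x.
have := @Lipschitz_cell R n K Khat (fun x => h x 0 i) Khat0 (hL i) N N0 x.
have := @Lipschitz_cell R n K Khat (fun x => h' x 0 i) Khat0 (hL' i) N N0 x.
have := hk (cell N x).
by rewrite !ler_norml; lra.
Qed.

(** Functions are classified by their values on the grid, rounded down in steps of [eps]. Each of
    the [n] components has a code with unit increments along the tree, and functions with equal
    codes are [eps]-close on the grid. *)
Lemma NPL_net (N : nat) (eps : R) : (0 < N)%N -> 0 < eps -> Khat / N%:R <= eps ->
  exists (I : finType) (c : I -> defender R n K -> 'rV[R]_n),
  [/\ (#|I| <= ((Num.truncn (M / eps)).+1 * 3 ^ #|{: grid n K N}|) ^ n)%N,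
      forall j, H (c j) &
      forall h, H h -> exists j, forall x i,
        `|h x 0 i - c j x 0 i| <= eps + 2 * (Khat * (n.+1%:R / N%:R))].
Proof.
move=> N0 eps0 KhatN.
set b := Num.truncn (M / eps).
pose G := grid n K N.
pose level (h : defender R n K -> 'rV[R]_n) i (k : G) :=
  (h (grid_point R N0 k) 0 i + M / 2) / eps.
have level_ge0 h i k : H h -> 0 <= level h i k.
  by move=> [hM _]; rewrite divr_ge0 ?(ltW eps0)//; have := hM (grid_point R N0 k) i; lra.
have level_lt h i k : H h -> (Num.truncn (level h i k) < b.+1)%N.
  move=> [hM _]; rewrite ltnS le_truncn// ler_pM2r ?invr_gt0//.
  by have := hM (grid_point R N0 k) i; lra.
pose code h : {ffun 'I_n -> {ffun G -> 'I_b.+1}} :=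
  [ffun i => [ffun k => inord (Num.truncn (level h i k))]].
pose good := [pred a : {ffun G -> 'I_b.+1} |
  [forall k, (a k <= (a (parent k)).+1)%N && (a (parent k) <= (a k).+1)%N]].
have codeE h i k : H h -> code h i k = Num.truncn (level h i k) :> nat.
  by move=> hH; rewrite !ffunE inordK// level_lt.
have code_good h : H h -> code h \in ffun_on good.
  move=> hH; apply/ffun_onP => i; rewrite inE; apply/forallP => k.
  (* [Khat / N%:R <= eps] is used here: along an edge the value moves by at most one step, hence so
     does its integer part. *)
  have : `|level h i k - level h i (parent k)| <= 1.
    rewrite /level -mulrBl normrM [`|eps^-1|]gtr0_norm ?invr_gt0//.
    rewrite ler_pdivrMr// mul1r opprD addrACA subrr addr0.
    have [_ hL] := hH; apply: le_trans (hL _ _ _) _; apply: le_trans KhatN.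
    by rewrite ler_wpM2l// l1_dist_parent.
  rewrite !codeE// !truncn_le_nat ler_norml => /andP[l u].
  have := truncnS_gt (level h i k); have := truncnS_gt (level h i (parent k)).
  by rewrite -!natr1 => ? ?; apply/andP; split; lra.
(* Codes that no member of [H] attains get the zero function, so that every centre lies in [H]. *)
pose rep phi : defender R n K -> 'rV[R]_n :=
  if pselect (exists2 h, H h & code h = phi) is left ex then s2val (cid2 ex)
  else (fun=> 0).
have repH phi : H (rep phi).
  by rewrite /rep; case: pselect => [ex|_]; [case: cid2|exact: NPL_class0].
have code_rep h : H h -> code (rep (code h)) = code h.
  move=> hH; rewrite /rep; case: pselect => [ex|]; first by case: cid2.
  by case; exists h.
exists {phi | phi \in ffun_on good}, (fun phi => rep (val phi)); split.
- rewrite card_sig card_ffun_on card_ord.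
  have leX x y k : (x <= y -> x ^ k <= y ^ k)%N.
    by case: k => // k; rewrite leq_exp2r.
  exact/leX/(card_tree_unit_increments _ (@grid_rank_parent n K N)).
- by move=> phi; exact: repH.
move=> h hH; exists (Sub (code h) (code_good h hH)) => x i /=.
set h' := rep (code h); have hH' : H h' := repH _.
have hk k : `|h (grid_point R N0 k) 0 i - h' (grid_point R N0 k) 0 i| <= eps.
  have := codeE h i k hH; rewrite -(code_rep _ hH) (codeE _ _ _ hH') => e.
  have := truncn_itv (level_ge0 _ i k hH).
  have := truncn_itv (level_ge0 _ i k hH'); rewrite -/h' e.
  move: (Num.truncn _) => t; rewrite -natr1 /level.
  rewrite !ler_pdivlMr// !ltr_pdivrMr// mulrDl mul1r ler_norml.
  by move: (t%:R * eps) => u /andP[? ?] /andP[? ?]; apply/andP; split; lra.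
exact: (NPL_close_on_grid hH hH' hk).
Qed.

End net.

(** * Loss, risk and their deviation *)

Section log_sum_exp.
Context (R : realType) (n : nat).
Implicit Types (a : 'rV[R]_n) (i : 'I_n.+1).

(** The softmax denominator; the summand 1 is the exponential of the last logit, fixed at 0. *)
Definition sum_exp a : R := 1 + \sum_(j < n) expR (a 0 j).

Lemma sum_exp_gt0 a : 0 < sum_exp a.
Proof. by rewrite ltr_pwDl// sumr_ge0// => j _; rewrite expR_ge0. Qed.

Lemma lossE i a : loss i a = ln (sum_exp a) - logit a i.
Proof.
have S0 := sum_exp_gt0 a; rewrite /loss -/(sum_exp a).
by rewrite ln_div ?posrE ?expR_gt0// expRK opprB.
Qed.

(** Every summand grows by a factor of at most [expR rho], including the constant 1 because
    [0 <= rho]. *)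
Lemma ln_sum_exp_le a a' (rho : R) : 0 <= rho ->
  (forall j, a 0 j <= rho + a' 0 j) -> ln (sum_exp a) <= rho + ln (sum_exp a').
Proof.
move=> rho0 aa'; have S0 := sum_exp_gt0 a'.
rewrite -[rho]expRK -lnM ?posrE ?expR_gt0// ler_ln ?posrE ?sum_exp_gt0//; last first.
  by rewrite mulr_gt0 ?expR_gt0.
rewrite /sum_exp mulrDr mulr1 lerD//; first by rewrite -expR0 ler_expR.
rewrite mulr_sumr; apply: ler_sum => j _.
by rewrite -expRD ler_expR.
Qed.

(** In the sup norm both the log-sum-exp and the logit are 1-Lipschitz, so the factor 2 does not
    depend on the number of targets. *)
Lemma loss_Lipschitz i a a' (rho : R) : 0 <= rho ->
  (forall j, `|a 0 j - a' 0 j| <= rho) -> `|loss i a - loss i a'| <= 2 * rho.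
Proof.
move=> rho0 aa'; rewrite !lossE.
have := @ln_sum_exp_le a a' rho rho0.
have := @ln_sum_exp_le a' a rho rho0.
have : `|logit a i - logit a' i| <= rho.
  by rewrite /logit; case: unlift => [j|]; rewrite ?subrr ?normr0.
rewrite !ler_norml => /andP[? ?] h1 h2.
have {}h1 : ln (sum_exp a') <= rho + ln (sum_exp a).
  by apply: h1 => j; have := aa' j; rewrite ler_norml => /andP[]; lra.
have {}h2 : ln (sum_exp a) <= rho + ln (sum_exp a').
  by apply: h2 => j; have := aa' j; rewrite ler_norml => /andP[]; lra.
by apply/andP; split; lra.
Qed.

Lemma loss0 i : loss i (0 : 'rV[R]_n) = ln n.+1%:R.
Proof.
rewrite lossE /logit /sum_exp; case: unlift => [j|]; rewrite ?mxE subr0.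
all: under eq_bigr do rewrite mxE expR0.
all: by rewrite sumr_const card_ord -natr1 addrC.
Qed.

End log_sum_exp.

Section deviation.
Context (R : realType) (n K : nat) (M Khat : R).
Hypotheses (M0 : 0 <= M) (Khat0 : 0 <= Khat).
Local Notation H := (NPL_class R n K M Khat).
Local Notation X := (defender R n K).
Implicit Types h : X -> 'rV[R]_n.

Definition example_loss h (z : observation R n K) : R := loss z.2 (h z.1).

(** For a fixed target the loss is Lipschitz in [x]; as targets are finitely many, preimages are
    finite unions of rectangles. *)
Lemma measurable_example_loss h : H h ->
  measurable_fun [set: observation R n K] (example_loss h).
Proof.
move=> [_ hL].
have mloss i : measurable_fun [set: X] (fun x => loss i (h x)).
  apply: (@Lipschitz_measurable _ _ _ (2 * Khat)); first by rewrite mulr_ge0.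
  move=> x x'; rewrite -mulrA; apply: loss_Lipschitz => [|j]; last exact: hL.
  by rewrite mulr_ge0// sumr_ge0.
move=> _ A mA; rewrite setTI.
have -> : example_loss h @^-1` A = \bigcup_(i in [set: 'I_n.+1])
    (fst @^-1` ((fun x => loss i (h x)) @^-1` A) `&` snd @^-1` [set i]).
  by apply/seteqP; split=> [[x i] Az|[x i] [j _ [/= + ij]]]; [exists i|rewrite -ij].
apply: fin_bigcup_measurable => // i _; apply: measurableI.
  rewrite -[X in measurable X]setTI; apply: measurable_fst => //.
  by rewrite -[X in measurable X]setTI; exact: mloss.
by rewrite -[X in measurable X]setTI; exact: measurable_snd.
Qed.

(* Centering at [ln T] makes the bound independent of the number of targets. *)
Lemma example_loss_bound h z : H h -> `|example_loss h z - ln n.+1%:R| <= M.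
Proof.
move=> [hM _]; rewrite -(loss0 R z.2).
have -> : M = 2 * (M / 2) by field.
apply: loss_Lipschitz => [|j]; first by rewrite divr_ge0.
by rewrite mxE subr0 ler_norml hM.
Qed.

Lemma example_loss_dist h h' (rho : R) z : 0 <= rho ->
  (forall x i, `|h x 0 i - h' x 0 i| <= rho) ->
  `|example_loss h z - example_loss h' z| <= 2 * rho.
Proof. by move=> rho0 hh'; exact: loss_Lipschitz. Qed.

Variable p : probability (observation R n K) R.

Lemma integrable_example_loss h : H h ->
  p.-integrable [set: observation R n K] (EFin \o example_loss h).
Proof.
move=> hH; apply: (@bounded_integrable _ _ _ _ _ (M + `|ln n.+1%:R|)).
  exact: measurable_example_loss.
move=> z; rewrite -[example_loss h z](subrK (ln n.+1%:R)).
by apply: le_trans (ler_normD _ _) _; rewrite lerD2r example_loss_bound.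
Qed.

(** Bounded losses make the extended-real risk finite, so deviations can be treated in [R]. *)
Lemma risk_Rintegral h : H h -> risk p h = (\int[p]_z example_loss h z)%:E.
Proof.
move=> hH; rewrite /risk unlock /Rintegral fineK//.
exact: integrable_fin_num (integrable_example_loss hH).
Qed.

Context d (W : measurableType d) (P : probability W R) (m : nat)
  (S : 'I_m -> {RV P >-> observation R n K}).
Hypothesis m0 : (0 < m)%N.

Definition deviation h (w : W) : R :=
  emp_risk [tuple S i w | i < m] h - \int[p]_z example_loss h z.

Lemma deviationE h w : deviation h w =
  m%:R^-1 * \sum_i (example_loss h (S i w) - \int[p]_z example_loss h z).
Proof.
have mR : m%:R != 0 :> R by rewrite pnatr_eq0 -lt0n.
rewrite /deviation /emp_risk sumrB mulrBr sumr_const card_ord.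
rewrite -[(\int[p]_z _) *+ m]mulr_natl mulKf//.
by congr (_ * _ - _); apply: eq_bigr => i _; rewrite tnth_mktuple.
Qed.

Lemma measurable_deviation h : H h -> measurable_fun [set: W] (deviation h).
Proof.
move=> hH.
have -> : deviation h = (fun w =>
    m%:R^-1 * \sum_i (example_loss h (S i w) - \int[p]_z example_loss h z)).
  by apply/funext => w; rewrite deviationE.
apply: measurable_realfun.measurable_funM; first exact: measurable_cst.
apply: measurable_sum => i; apply: measurable_realfun.measurable_funB => //.
exact: (measurableT_comp (measurable_example_loss hH)).
Qed.

Lemma measurable_deviation_lt h a : H h ->
  measurable [set w | `|deviation h w| < a].
Proof.
move=> hH.
have mD : measurable_fun [set: W] (fun w => `|deviation h w|).
  by apply: measurableT_comp => //; exact: measurable_deviation.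
have := mD measurableT `]-oo, a[%classic (measurable_itv _); rewrite setTI.
by congr measurable; apply/seteqP; split=> w /=; rewrite in_itv.
Qed.

(** The empirical risk and the risk each move by at most [2 * rho]. *)
Lemma deviation_dist h h' (rho : R) w : H h -> H h' -> 0 <= rho ->
  (forall x i, `|h x 0 i - h' x 0 i| <= rho) ->
  `|deviation h w - deviation h' w| <= 4 * rho.
Proof.
move=> hH hH' rho0 hh'.
have mR : 0 < m%:R :> R by rewrite ltr0n.
have := @Rintegral_dist_le _ _ _ p _ _ (2 * rho) (integrable_example_loss hH)
  (integrable_example_loss hH') (fun z => example_loss_dist z rho0 hh').
have : `|emp_risk [tuple S i w | i < m] h - emp_risk [tuple S i w | i < m] h'| <=
    2 * rho.
  rewrite /emp_risk -mulrBr -sumrB normrM gtr0_norm ?invr_gt0// ler_pdivrMl//.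
  apply: le_trans (ler_norm_sum _ _ _) _.
  rewrite -[m in m%:R]card_ord (mulr_natl (2 * rho)) -sumr_const.
  apply: ler_sum => i _.
  exact: (example_loss_dist (tnth [tuple S i w | i < m] i) rho0 hh').
rewrite /deviation; move: (emp_risk _ h) (emp_risk _ h') => a a'.
move: (Rintegral _ _ _) (Rintegral _ _ _) => b b'.
by rewrite !ler_norml => /andP[? ?] /andP[? ?]; apply/andP; split; lra.
Qed.

(** Hoeffding is applied to the loss minus [ln n.+1%:R], which is bounded by [M]; the shift cancels
    in the deviation. *)
Lemma deviation_tail h (t : R) : iid p S -> 0 < M -> H h -> 0 < t -> t <= 8 * M ->
  (P [set w | (t <= `|deviation h w|)%R] <=
  (2 * expR (- (m%:R * t ^+ 2 / (128 * M ^+ 2))))%:E)%E.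
Proof.
move=> SP M_gt0 hH t0 tM.
have mR : 0 < m%:R :> R by rewrite ltr0n.
pose f z := example_loss h z - ln n.+1%:R.
have mf : measurable_fun [set: observation R n K] f.
  apply: measurable_realfun.measurable_funB => //.
  exact: measurable_example_loss.
have fM z : `|f z| <= M by exact: example_loss_bound.
have intf : \int[p]_z f z = \int[p]_z example_loss h z - ln n.+1%:R.
  rewrite RintegralB ?Rintegral_probability_cst//.
    exact: integrable_example_loss.
  by apply: (@bounded_integrable _ _ _ _ _ `|ln n.+1%:R|).
apply: le_trans (Hoeffding_bounded SP mf M_gt0 fM t0 tM).
rewrite le_eqVlt; apply/orP; left; apply/eqP; congr (P _).
apply/seteqP; split=> w /=; rewrite deviationE intf normrM.
all: rewrite gtr0_norm ?invr_gt0// ler_pdivlMl//.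
all: suff -> : \sum_i (f (S i w) - (\int[p]_z example_loss h z - ln n.+1%:R)) =
  \sum_i (example_loss h (S i w) - \int[p]_z example_loss h z) by [].
all: by apply: eq_bigr => i _; rewrite /f; ring.
Qed.

End deviation.

(** * Compactness and measurability of the uniform event *)

Lemma nbhs_finite_coords (R : realType) (I : eqType)
    (f : prod_topology (fun _ : I => R)) (s : seq I) (e : R) : 0 < e ->
  nbhs f [set g | forall i, i \in s -> `|g i - f i| < e].
Proof.
move=> e0.
have fi i : nbhs f [set g | `|g i - f i| < e].
  have pc := @proj_continuous I (fun=> R) i f.
  have nb : nbhs (f i) [set y : R | `|y - f i| < e].
    apply/nbhs_ballP; exists e => // y /=; by rewrite /ball/= distrC.
  exact: (pc _ nb).
elim: s => [|i s ih].
  have -> : [set g : I -> R | forall i, i \in [::] -> `|g i - f i| < e] = setT.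
    apply/seteqP; split => //.
  exact: (@filterT _ _ (nbhs_filter f)).
have nf := nbhs_filter f.
apply: (@filterS _ _ nf) (@filterI _ _ nf _ _ (fi i) ih) => g [/= gi gs] j.
rewrite in_cons => /predU1P[->|js].
  exact: gi.
exact: gs.
Qed.

(** The cube is compact by Tychonoff, but for uncountable [I] it need not be sequentially compact;
    hence a cluster point, with [k] depending on [s], [e] and [N], in place of a convergent
    subsequence. *)
Lemma pointwise_cluster (R : realType) (I : eqType) (u : nat -> I -> R) (b : R) :
  (forall k i, `|u k i| <= b) ->
  exists f : I -> R, forall (s : seq I) (e : R) (N : nat), 0 < e ->
    exists2 k, (N <= k)%N & forall i, i \in s -> `|u k i - f i| < e.
Proof.
move=> ub.
have cA := @tychonoff I (fun=> R) (fun=> `[- b, b]%classic)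
  (fun=> @segment_compact R (- b) b).
have [|f [_ fcl]] := cA (u @ \oo) _.
  by exists 0%N => // k _ i /=; rewrite in_itv/= -ler_norml.
exists f => s e N e0.
have fB := @nbhs_finite_coords R I f s e e0.
have uN : (u @ \oo) (u @` [set k | (N <= k)%N]).
  by exists N => // k /= Nk; exists k.
have [g [[k /= Nk <-] gB]] := fcl _ _ uN fB.
by exists k.
Qed.

Section uniform_deviation.
Context (R : realType) (n K : nat) (M Khat : R).
Hypotheses (M0 : 0 <= M) (Khat0 : 0 <= Khat).
Local Notation H := (NPL_class R n K M Khat).
Local Notation X := (defender R n K).

(** The first bound on [N] controls the Lipschitz error, the last one the size of the grid. *)
Lemma small_mesh (r : R) : 0 < r ->
  exists N, [/\ (0 < N)%N, Khat * (n.+1%:R / N%:R) <= r &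
    N%:R <= Khat * n.+1%:R / r + 1].
Proof.
move=> r0; exists (Num.truncn (Khat * n.+1%:R / r)).+1; split=> //.
  rewrite mulrA ler_pdivrMr ?ltr0n// [r * _]mulrC -ler_pdivrMr//.
  exact/ltW/truncnS_gt.
by rewrite -natr1 lerD2r truncn_le divr_ge0 ?mulr_ge0// ltW.
Qed.

(** Membership in [H] tests at most two points at a time and so passes to a pointwise cluster point;
    closeness on a finite grid becomes uniform by the Lipschitz condition. *)
Lemma NPL_cluster (u : nat -> X -> 'rV[R]_n) : (forall k, H (u k)) ->
  exists2 h, H h & forall (rho : R) N, 0 < rho ->
    exists2 k, (N <= k)%N & forall x i, `|u k x 0 i - h x 0 i| <= rho.
Proof.
move=> uH.
have [f fP] := @pointwise_cluster R (X * 'I_n)%type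
  (fun k xi => u k xi.1 0 xi.2) (M / 2) (fun k xi => let: conj uM _ := uH k in
    etrans (ler_norml _ _) (uM xi.1 xi.2)).
pose h x : 'rV[R]_n := \row_i f (x, i).
have hH : H h.
  split=> [x i|i x x']; rewrite !mxE.
    have key e : 0 < e -> - (M / 2) <= f (x, i) + e /\ f (x, i) <= M / 2 + e.
      move=> e0; have [k _ /(_ _ (mem_head _ _))/=] := fP [:: (x, i)] e 0%N e0.
      by have [/(_ x i)] := uH k; rewrite ltr_norml; split; lra.
    by apply/andP; split; apply/ler_addgt0Pr => e /key[].
  apply/ler_addgt0Pr => e e0.
  have e20 : 0 < e / 2 by rewrite divr_gt0.
  have [k _ fk] := fP [:: (x, i); (x', i)] (e / 2) 0%N e20.
  have /= := fk (x, i) (mem_head _ _).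
  have /= := fk (x', i); rewrite !inE eqxx orbT => /(_ isT).
  have [_ /(_ i x x')] := uH k.
  by rewrite !ltr_norml !ler_norml; lra.
exists h => // rho N rho0.
(* The budget [rho] splits into [rho / 2] on the grid and [2 * (rho / 4)] for leaving it. *)
have [|Ng [Ng0 mesh _]] := @small_mesh (rho / 4); first by rewrite divr_gt0.
have [|k Nk fk] := fP
  [seq (grid_point R Ng0 g, i) | g <- enum {: grid n K Ng}, i <- enum 'I_n]
  (rho / 2) N; first by rewrite divr_gt0.
exists k => // x i.
apply: (@le_trans _ _ (rho / 2 + 2 * (Khat * (n.+1%:R / Ng%:R)))); last by lra.
apply: (NPL_close_on_grid Khat0 (uH k) hH) => g; rewrite mxE; apply/ltW.
by apply: (fk (_, _)); apply: allpairs_f; rewrite mem_enum.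
Qed.

Context d (W : measurableType d) (P : probability W R) (m : nat)
  (S : 'I_m -> {RV P >-> observation R n K}) (p : probability (observation R n K) R).
Hypothesis m0 : (0 < m)%N.

(* [H] is compact, so the supremum of the deviation over [H] is attained and is
   thus bounded away from [a] as soon as all values are less than [a]. *)
Lemma measurable_uniform_deviation (a : R) :
  measurable [set w | forall h, H h -> `|deviation p S h w| < a].
Proof.
have quarter (g v : R) : 16 < v * g -> 4 < g / 4 * v by lra.
have gap (x y v : R) : 0 < a - x -> a - 4 * v <= y -> 4 * v < (a - x) / 4 ->
  y - x <= 4 * ((a - x) / 16) -> False by lra.
have nets k : exists Ic : {I : finType & I -> X -> 'rV[R]_n},
    (forall j, H (projT2 Ic j)) /\ forall h, H h -> exists j, forall x i,
      `|h x 0 i - projT2 Ic j x 0 i| <= k.+1%:R^-1.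
  have e0 : 0 < (k.+1%:R^-1 / 4 : R) by rewrite divr_gt0.
  have [N [N0 mesh _]] := small_mesh e0.
  have [|I [c [_ cH cnet]]] := @NPL_net R n K M Khat M0 Khat0 N (k.+1%:R^-1 / 4) N0 e0.
    apply: le_trans mesh; rewrite mulrA ler_pM2r ?invr_gt0 ?ltr0n//.
    by rewrite ler_peMr// ler1n.
  exists (existT _ I c); split=> // h /cnet[j hj]; exists j => x i.
  apply: le_trans (hj x i) _; move: mesh e0.
  by move: (Khat * _) (k.+1%:R^-1) => c0 v; lra.
have [net netP] := choice nets.
(* The slack [4 * k.+1%:R^-1] pays for replacing [h] by a point of the net of radius
   [k.+1%:R^-1]. *)
have -> : [set w | forall h, H h -> `|deviation p S h w| < a] =
    \bigcup_k \bigcap_(j in [set: projT1 (net k)])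
      [set w | `|deviation p S (projT2 (net k) j) w| < a - 4 * k.+1%:R^-1].
  apply/seteqP; split=> [w Dw|w [k _ Dw] h hH] /=; last first.
    have [cH /(_ _ hH)[j hj]] := netP k.
    have := deviation_dist M0 Khat0 p S m0 w hH (cH j) _ hj.
    rewrite invr_ge0 => /(_ (ler0n _ _)).
    have /= := Dw j I.
    move: (deviation p S h w) (deviation p S _ w) (_^-1) => x y v.
    by rewrite !ltr_norml ler_norml; lra.
  (* Otherwise every [k] has a member of [H] breaking the tightened bound; a cluster point [h] of
     these is compared with its own gap [g] below [a]. *)
  apply: contrapT => nE.
  have /choice[u uP] : forall k, exists h,
      H h /\ a - 4 * k.+1%:R^-1 <= `|deviation p S h w|.
    move=> k; apply: contrapT => nk; apply: nE; exists k => // j _ /=.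
    rewrite ltNge; apply/negP => ja; apply: nk; exists (projT2 (net k) j).
    by split=> //; have [] := netP k.
  have [|h hH hu] := @NPL_cluster u; first by move=> k; have [] := uP k.
  have := Dw _ hH; rewrite -subr_gt0; set g := a - _ => g0.
  (* Distance [g / 16] from [h] costs [g / 4], and [16 / g < k.+1%:R] makes the slack less than
     [g / 4]; together they cannot fill the gap [g]. *)
  have [|k Nk uk] := hu (g / 16) (Num.truncn (16 / g)); first by rewrite divr_gt0.
  have [ukH uka] := uP k.
  have := deviation_dist M0 Khat0 p S m0 w ukH hH _ uk.
  rewrite divr_ge0 ?(ltW g0)// => /(_ isT)/(le_trans (lerB_dist _ _)) dist_uk.
  have small_k : 4 * k.+1%:R^-1 < g / 4.
    have : 16 / g < k.+1%:R.
      by apply: lt_le_trans (truncnS_gt _) _; rewrite ler_nat.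
    by rewrite ltr_pdivrMr// [4 / _ < _]ltr_pdivrMr ?ltr0n//; exact: quarter.
  exact: gap g0 uka small_k dist_uk.
apply: bigcup_measurable => k _; apply: fin_bigcap_measurable => // j _.
have [netH _] := netP k.
exact: measurable_deviation_lt (netH j).
Qed.

End uniform_deviation.

(** * Sample complexity *)

Lemma ffact_le_expn (a b : nat) : (a ^_ b <= a ^ b)%N.
Proof.
elim: b a => [|b ih] a; first by rewrite ffactn0 expn0.
rewrite ffactnS expnS leq_mul2l (leq_trans (ih _)) ?orbT//.
by case: b {ih} => [|b]; rewrite ?expn0// leq_exp2r// leq_pred.
Qed.

(* [c ^ T / T!] is bounded uniformly in [T], which is why only the corner
   [sum x_i <= K] of the cube gives a constant independent of [T]. *)
Lemma bin_le_expR (R : realType) (a b : nat) (c x : R) : 0 <= c -> 0 <= x ->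
  a%:R <= c * x -> 'C(a, b.+1)%:R <= expR c * x ^+ b.+1.
Proof.
move=> c0 x0 acx.
have f0 : 0 < b.+1`!%:R :> R by rewrite ltr0n fact_gt0.
have h1 : 'C(a, b.+1)%:R * b.+1`!%:R <= (c * x) ^+ b.+1.
  rewrite -natrM bin_ffact; apply: le_trans (_ : a%:R ^+ b.+1 <= _).
    by rewrite -natrX ler_nat ffact_le_expn.
  by rewrite lerXn2r ?nnegrE ?mulr_ge0.
apply: (@le_trans _ _ (c ^+ b.+1 / b.+1`!%:R * x ^+ b.+1)).
  by rewrite mulrAC -exprMn ler_pdivlMr.
rewrite ler_wpM2r ?exprn_ge0//; apply: le_trans (expR_ge1Dxn b c0).
by rewrite lerDr.
Qed.

Section theorem3_constants.
Context (R : realType) (M Khat : R) (K : nat).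
Hypotheses (M1 : 1 < M) (Khat0 : 0 < Khat).
Let M_gt0 : 0 < M. Proof. exact: lt_trans M1. Qed.

(** With mesh parameter [alpha / 96], this times [T / alpha] bounds the upper index [T + K * N] of
    the binomial coefficient counting the grid. *)
Definition simplex_const : R := K%:R * (96 * Khat + 1) + 1.

(** The first term accounts for the [alpha / 48]-levels of one root value, the second for three
    increments per grid point, as [3 <= expR 2]. *)
Definition entropy_const : R := 48 * M + 2 * expR simplex_const.

(* [36 * 128 * M ^ 2] is the denominator in the tail of a deviation [alpha / 6]. *)
Definition sample_const : R := 36 * (128 * M ^+ 2) * (entropy_const + 4).

Lemma entropy_const_gt0 : 0 < entropy_const.
Proof.
rewrite /entropy_const; have := expR_gt0 simplex_const.
by move: (expR _) M_gt0 => e; lra.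
Qed.

Lemma sample_const_gt0 : 0 < sample_const.
Proof.
have B0 : 0 < M ^+ 2 by rewrite exprn_gt0.
have c0 := entropy_const_gt0.
apply: mulr_gt0; last exact: addr_gt0.
by apply: mulr_gt0 => //; exact: mulr_gt0.
Qed.

Variables (n : nat) (alpha : R).
Hypothesis alpha01 : 0 < alpha < 1.
Let alpha0 : 0 < alpha. Proof. by case/andP: alpha01. Qed.
Let alpha1 : alpha < 1. Proof. by case/andP: alpha01. Qed.

Local Notation complexity := (n.+1%:R ^+ n.+2 / alpha ^+ n.+1).

(** The power bounds the log-cardinality for one component up to a constant; the extra factor [T]
    absorbs the [n] components. *)
Lemma complexityE : complexity = n.+1%:R * (n.+1%:R / alpha) ^+ n.+1.
Proof. by rewrite [in RHS]exprMn exprVn mulrA -exprS. Qed.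

Lemma inv_alpha_ge1 : 1 <= n.+1%:R / alpha.
Proof.
rewrite ler_pdivlMr// mul1r (le_trans (ltW alpha1))//.
by rewrite ler1n.
Qed.

Lemma complexity_ge1 : 1 <= complexity.
Proof. by rewrite complexityE mulr_ege1 ?ler1n// exprn_ege1// inv_alpha_ge1. Qed.

Lemma net_card_le (N : nat) (c : nat) :
  N%:R <= Khat * n.+1%:R / (alpha / 96) + 1 ->
  (c <= ((Num.truncn (M / (alpha / 48))).+1 * 3 ^ #|{: grid n K N}|) ^ n)%N ->
  c%:R <= expR (entropy_const * complexity).
Proof.
move=> NE; rewrite -(ler_nat R) => /le_trans; apply.
set U := (n.+1%:R / alpha) ^+ n.+1.
have U1 : 1 <= U by rewrite exprn_ege1// inv_alpha_ge1.
have aU : alpha^-1 <= U.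
  apply: (@le_trans _ _ (n.+1%:R / alpha)).
    by rewrite ler_peMl ?invr_ge0 ?ler1n// ltW.
  by rewrite ler_eXnr// inv_alpha_ge1.
have gridU : #|{: grid n K N}|%:R <= expR simplex_const * U.
  rewrite card_grid; apply: bin_le_expR.
  - by rewrite addr_ge0// mulr_ge0// addr_ge0// mulr_ge0// ltW.
  - by rewrite divr_ge0// ltW.
  rewrite natrD natrM; apply: (@le_trans _ _
    (n.+1%:R + K%:R * (Khat * n.+1%:R / (alpha / 96) + 1))).
    by rewrite lerD2l ler_wpM2l.
  have -> : Khat * n.+1%:R / (alpha / 96) = 96 * Khat * (n.+1%:R / alpha).
    by field; rewrite gt_eqF.
  have Ta : n.+1%:R <= n.+1%:R / alpha :> R.
    by rewrite ler_peMr// invf_ge1// ltW.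
  have K0 : 0 <= K%:R * (n.+1%:R / alpha - 1).
    by rewrite mulr_ge0// subr_ge0 inv_alpha_ge1.
  rewrite /simplex_const; move: Ta K0.
  by move: (n.+1%:R / alpha) n.+1%:R => v T; nra.
have base : ((Num.truncn (M / (alpha / 48))).+1 * 3 ^ #|{: grid n K N}|)%:R <=
    expR (entropy_const * U).
  rewrite natrM natrX /entropy_const mulrDl expRD; apply: ler_pM => //.
    rewrite -natr1 addrC; apply: le_trans (expR_ge1Dx _) _; rewrite ler_expR.
    apply: (@le_trans _ _ (M / (alpha / 48))).
      by rewrite truncn_le divr_ge0 ?divr_ge0 ?(ltW alpha0) ?(ltW M_gt0).
    have -> : M / (alpha / 48) = 48 * M * alpha^-1 by field; rewrite gt_eqF.
    by rewrite ler_wpM2l// mulr_ge0// ltW.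
  apply: (@le_trans _ _ (expR (#|{: grid n K N}|%:R * 2))).
    rewrite expRM_natl lerXn2r ?nnegrE ?expR_ge0//.
    by apply: le_trans (expR_ge1Dx _); lra.
  by rewrite ler_expR mulrC -mulrA ler_wpM2l.
rewrite natrX; apply: le_trans (lerXn2r _ _ _ base) _; rewrite ?nnegrE ?expR_ge0//.
rewrite -expRM_natl ler_expR complexityE -/U [leRHS]mulrCA.
by rewrite ler_wpM2r ?ler_nat// mulr_ge0 ?ltW ?entropy_const_gt0// (lt_le_trans _ U1).
Qed.

(** The sample size makes the exponent exceed [ln (1 / delta)] plus the logarithmic bound on the net
    plus 4. *)
Lemma union_bound_lt (delta : R) (m : nat) (c : R) : 0 < delta < 1 ->
  sample_const / alpha ^+ 2 * (ln (1 / delta) + complexity) <= m%:R ->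
  c <= expR (entropy_const * complexity) ->
  c * (2 * expR (- (m%:R * (alpha / 6) ^+ 2 / (128 * M ^+ 2)))) < delta / 2.
Proof.
move=> /andP[delta0 delta1] hm hc.
set x := m%:R * _ / _.
have V1 := complexity_ge1; set V := complexity in hc hm V1 *.
have L0 : 0 <= ln (1 / delta).
  by rewrite ln_ge0// div1r invf_ge1// ltW.
have c2 := entropy_const_gt0.
have xE : (entropy_const + 4) * (ln (1 / delta) + V) <= x.
  have -> : x = m%:R * (alpha ^+ 2 / (36 * (128 * M ^+ 2))).
    by rewrite /x; field; rewrite gt_eqF.
  apply: le_trans (ler_wpM2r _ hm); last first.
    by rewrite divr_ge0 ?mulr_ge0 ?exprn_ge0 ?(ltW alpha0) ?(ltW M_gt0).
  rewrite le_eqVlt; apply/orP; left; apply/eqP.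
  by rewrite /sample_const; field; rewrite !gt_eqF.
(* The additive 4 comes from [4 * V], because [1 <= V]. *)
have xL : ln (1 / delta) + entropy_const * V + 4 <= x.
  by apply: le_trans xE; nra.
have eL : expR (- ln (1 / delta)) = delta.
  by rewrite expRN lnK ?posrE ?divr_gt0// div1r invrK.
apply: (@le_lt_trans _ _ (expR (entropy_const * V) * (2 * expR (- x)))).
  by rewrite ler_wpM2r// mulr_ge0// expR_ge0.
apply: (@le_lt_trans _ _ (2 * (delta * expR (- 4)))).
  rewrite mulrCA ler_wpM2l// -expRD -eL -expRD ler_expR.
  by move: xL; lra.
(* This pays for the factor 2 of the two-sided tail and for the half in [delta / 2]. *)
have e4 : expR (- 4) < 4^-1 :> R.
  rewrite expRN ltf_pV2 ?posrE ?expR_gt0//.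
  by apply: lt_le_trans (expR_ge1Dx _); lra.
have : delta * expR (- 4) < delta * 4^-1 by rewrite ltr_pM2l.
lra.
Qed.

End theorem3_constants.

(** * The learning algorithm and the uniform deviation bound *)

Section learning.
Context (R : realType) (n K : nat) (M Khat : R).
Hypotheses (M1 : 1 < M) (Khat0 : 0 < Khat).
Local Notation H := (NPL_class R n K M Khat).
Let M_gt0 : 0 < M. Proof. exact: lt_trans M1. Qed.
Let M0 : 0 <= M. Proof. exact: ltW. Qed.
Let Khat_ge0 : 0 <= Khat. Proof. exact: ltW. Qed.

(** Losses are at least [ln n.+1%:R - M], so the infimum is finite and is approached within any
    positive [a]. *)
Lemma near_minimizer (m : nat) (a : R) (z : m.-tuple (observation R n K)) :
  0 < a -> exists h, H h /\
    `|emp_risk z h - inf [set emp_risk z h | h in H]| < a.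
Proof.
move=> a0; set E := [set _ | _ in _].
have infE : has_inf E.
  split; first by exists (emp_risk z (fun=> 0)), (fun=> 0) => //; exact: NPL_class0.
  exists (m%:R^-1 * \sum_(i < m) (ln n.+1%:R - M)) => _ [h hH <-].
  rewrite ler_wpM2l ?invr_ge0//; apply: ler_sum => i _.
  have := @example_loss_bound R n K M Khat M0 h (tnth z i) hH.
  by rewrite ler_norml /example_loss; move: (loss _ _) (ln _) => x y; lra.
have [_ [h hH <-] ha] := inf_adherent a0 infE.
exists h; split => //.
have := ge_inf infE.2 (ex_intro2 _ _ h hH erefl : E (emp_risk z h)).
by move: ha; move: (emp_risk z h) (inf E) => x y; rewrite ltr_norml; lra.
Qed.

(** The net has radius [alpha / 48 + 2 * (alpha / 96) = alpha / 24], so passing to it changes a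
    deviation by at most [alpha / 6]. A deviation of [alpha / 3] in [H] leaves [alpha / 6] at a net
    point, to which the union bound applies. *)
Lemma uniform_deviation_prob d (W : measurableType d) (P : probability W R) (m : nat)
    (S : 'I_m -> {RV P >-> observation R n K})
    (p : probability (observation R n K) R) (alpha delta : R) :
  iid p S -> (0 < m)%N -> 0 < alpha < 1 -> 0 < delta < 1 ->
  sample_const M Khat K / alpha ^+ 2 *
    (ln (1 / delta) + n.+1%:R ^+ n.+2 / alpha ^+ n.+1) <= m%:R ->
  prob_gt P [set w | forall h, H h -> `|deviation p S h w| < alpha / 3]
    (1 - delta / 2).
Proof.
move=> SP m0 alpha01 delta01 hm.
have /andP[alpha0 alpha1] := alpha01.
have gap (x y : R) : alpha / 3 <= x -> x - y <= 4 * (alpha / 24) ->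
    alpha / 6 <= y by lra.
have alpha_M : alpha / 6 <= 8 * M by move: M1; lra.
have mE := measurable_uniform_deviation M0 Khat_ge0 S p m0 (alpha / 3).
split=> //; set E := [set w | _] in mE *.
have a6 : 0 < alpha / 6 by rewrite divr_gt0.
have a48 : 0 < alpha / 48 by rewrite divr_gt0.
have a96 : 0 < alpha / 96 by rewrite divr_gt0.
have [N [N0 mesh NE]] := small_mesh n Khat_ge0 a96.
have [|I [c [cardI cH cnet]]] :=
  @NPL_net R n K M Khat M0 Khat_ge0 N _ N0 a48.
  apply: (@le_trans _ _ (Khat * (n.+1%:R / N%:R))); last by move: mesh; lra.
  rewrite ler_wpM2l// ler_peMl ?invr_ge0// ler1n//.
have mT j : measurable [set w | alpha / 6 <= `|deviation p S (c j) w| ].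
  have := measurable_deviation_lt Khat_ge0 p S m0 (alpha / 6) (cH j).
  move=> /measurableC; congr measurable; apply/seteqP; split=> w /=.
    by move/negP; rewrite -leNgt.
  by rewrite leNgt => /negP.
have bad : (P (~` E) < (delta / 2)%:E)%E.
  apply: (@le_lt_trans _ _
      (\sum_(j : I) P [set w | (alpha / 6 <= `|deviation p S (c j) w|)%R])%E).
    apply: measure_le_sum_fin => //; first exact: measurableC.
    move=> w /existsNP[h /not_implyP[hH /negP]]; rewrite -leNgt => hw.
    have [j hj] := cnet _ hH; exists j; first exact: isT.
    have rho0 : 0 <= alpha / 24 by rewrite divr_ge0// ltW.
    have hj' x i : `|h x 0 i - c j x 0 i| <= alpha / 24.
      apply: le_trans (hj x i) _; move: mesh.
      by move: (Khat * _) => y; lra.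
    have := deviation_dist M0 Khat_ge0 p S m0 w hH (cH j) rho0 hj'.
    move/(le_trans (lerB_dist _ _)) => hd.
    exact: gap hw hd.
  apply: (@le_lt_trans _ _ (#|I|%:R * (2 * expR (- (m%:R * (alpha / 6) ^+ 2 /
      (128 * M ^+ 2)))))%:E).
    rewrite mulr_natl -sumr_const -sumEFin; apply: lee_sum => j _.
    exact: (deviation_tail M0 Khat_ge0 m0 SP M_gt0 (cH j) a6 alpha_M).
  rewrite lte_fin; apply: (union_bound_lt M1 alpha01 delta01 hm).
  exact: (net_card_le M1 Khat0 alpha01 NE cardI).
move: bad; rewrite probability_setC//.
have PEfin : P E \is a fin_num by exact: fin_num_measure.
rewrite -(fineK PEfin) -EFinB !lte_fin.
by move: (fine _) => x; lra.
Qed.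

End learning.

Unset Implicit Arguments.
Set Strict Implicit.

Theorem theorem3 (R : realType) (M Khat : R) (K : nat) :
  1 < M -> 0 < Khat -> (1 <= K)%N ->
  exists2 C : R, 0 < C &
    forall (T n : nat), T = n.+1 -> (2 <= T)%N -> (K < T)%N ->
    forall alpha delta : R, 0 < alpha < 1 -> 0 < delta < 1 ->
    forall m : nat,
      C / alpha ^+ 2 *
        (ln (1 / delta) + T%:R ^+ T.+1 / alpha ^+ T) <= m%:R ->
      PAC_learnable (NPL_class R n K M Khat) alpha delta m.
Proof.
move=> M1 Khat0 _; exists (sample_const M Khat K); first exact: sample_const_gt0.
move=> _ n -> _ _ alpha delta alpha01 delta01 m hm.
have /andP[alpha0 alpha1] := alpha01; have /andP[delta0 delta1] := delta01.
have m0 : (0 < m)%N.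
  rewrite -(ltr0n R); apply: lt_le_trans hm.
  rewrite mulr_gt0 ?divr_gt0 ?exprn_gt0 ?sample_const_gt0//.
  rewrite ltr_wpDl//; first by rewrite ln_ge0// div1r invf_ge1// ltW.
  by rewrite divr_gt0 ?exprn_gt0.
have a30 : 0 < alpha / 3 by rewrite divr_gt0.
have [A AP] := choice (fun z : m.-tuple (observation R n K) =>
  near_minimizer M1 Khat0 z a30).
exists A; split=> [z|p d W P S SP z]; first by have [] := AP z.
have M0 : 0 <= M by rewrite ltW// (lt_trans _ M1).
split.
  rewrite (_ : [set w | _] =
      [set w | forall h, NPL_class R n K M Khat h -> `|deviation p S h w| < alpha / 3]).
    exact: uniform_deviation_prob.
  apply/seteqP; split=> w /= Dw h hH; have := Dw h hH.
    by rewrite (risk_Rintegral M0 (ltW Khat0) p hH) -EFinB abse_EFin lte_fin.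
  by rewrite (risk_Rintegral M0 (ltW Khat0) p hH) -EFinB abse_EFin lte_fin.
(* [A] is near-optimal on every sample, so the second event is the whole space. *)
rewrite (_ : [set w | _] = setT); last first.
  by apply/seteqP; split=> w // _; have [] := AP (z w).
split; first exact: measurableT.
rewrite (_ : P setT = 1%E); last exact: probability_setT.
by rewrite lte_fin; lra.
Qed.
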